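(* Let $G=(V,E,m,\mu)$ be an unweighted normalized graph satisfying the $\mathrm{CD}(0,\infty)$ condition whose girth is at least $5$. Then the graph $(V,E)$ is (isomorphic to) one of the following: (a) a path graph $P_k$ ($k\geq 1$), a cycle graph $C_n$ ($n\geq 5$), the infinite line $P_{\mathbb{Z}}$, or the infinite half line $P_{\mathbb{N}}$; (b) a star graph $\mathrm{Star}_n$ ($n\geq 3$), or $\mathrm{Star}_3^i$ ($1\leq i\leq 3$).
   Context: All graphs $(V,E)$ are undirected, connected, locally finite and simple (finite or infinite, with more than one vertex). Write $x\sim y$ if $\{x,y\}\in E$, and let $\mathrm{d}_x$ be the number of neighbors of $x$. An unweighted normalized graph is a graph $(V,E)$ with edge weights $\mu_{xy}=1$ for all $\{x,y\}\in E$ and vertex weights $m_x=\sum_{y\sim x}\mu_{xy}=\mathrm{d}_x$. For $f,g:V\to\mathbb{R}$: $\Delta f(x)=\frac{1}{m_x}\sum_{y\sim x}\mu_{xy}(f(y)-f(x))$, $\Gamma(f,g)=\frac12(\Delta(fg)-f\Delta g-g\Delta f)$, $\Gamma(f)=\Gamma(f,f)$, $\Gamma_2(f)=\frac12\Delta\Gamma(f)-\Gamma(f,\Delta f)$. The graph satisfies $\mathrm{CD}(0,\infty)$ if $\Gamma_2(f)(x)\geq 0$ for all $f:V\to\mathbb{R}$ and all $x\in V$. A cycle of length $k>2$ is a walk $x_0\sim x_1\sim\cdots\sim x_k$ with $x_0=x_k$ and $x_0,\dots,x_{k-1}$ pairwise distinct. The girth of a vertex is the minimal length of cycles passing through it ($\infty$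 if there is none), and the girth of the graph is the infimum of the girths of its vertices. $P_k$ is the path with $k$ edges ($k+1$ vertices); $C_n$ is the cycle graph with $n$ vertices; $P_{\mathbb{Z}}$ (resp. $P_{\mathbb{N}}$) is the graph on $\mathbb{Z}$ (resp. $\mathbb{N}$) with $i\sim i+1$ for all $i$; $\mathrm{Star}_n$ is the star with one center joined to $n$ leaves; $\mathrm{Star}_3^i$ is the 3-star with $i$ edges added, i.e. the tree obtained from $\mathrm{Star}_3$ by choosing $i$ of its three leaves and attaching to each chosen leaf one new pendant edge (with one new vertex). *)

(* Defs.v *)
From HB Require Import structures.
From mathcomp Require Import all_boot all_order all_algebra.
From mathcomp Require Import all_classical all_reals ereal.

Set Implicit Arguments.
Unset Strict Implicit.
Unset Printing Implicit Defensive.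

Import Order.TTheory GRing.Theory Num.Theory.
Local Open Scope classical_set_scope.
Local Open Scope ring_scope.

Record sgraph := SGraph {
  vertex :> choiceType;
  adj : rel vertex;
  adj_sym : symmetric adj;
  adj_irr : irreflexive adj }.

Definition nbrs (G : sgraph) (x : G) : set G := [set y | adj x y].

Definition locally_finite (G : sgraph) : Prop :=
  forall x : G, finite_set (nbrs x).

Definition connected_graph (G : sgraph) : Prop :=
  forall x y : G, exists2 p : seq G, path (@adj G) x p & last x p = y.

Definition nontrivial_graph (G : sgraph) : Prop := exists x y : G, x != y.

(* A cycle x_0 ~ x_1 ~ ... ~ x_k = x_0 is encoded by the sequence
   [:: x_0; ...; x_(k-1)], whose size is its length k. *)
Definition is_graph_cycle (G : sgraph) (c : seq G) : Prop :=
  (2 < size c)%N /\ ucycle (@adj G) c.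

(* The infimum of a nonempty set of natural numbers is its minimum, and
   ereal_inf set0 = +oo. *)
Definition vertex_girth (R : realType) (G : sgraph) (x : G) : \bar R :=
  ereal_inf [set (size c)%:R%:E | c in [set c | is_graph_cycle c /\ x \in c]].

Definition girth (R : realType) (G : sgraph) : \bar R :=
  ereal_inf (range (@vertex_girth R G)).

Definition unweighted_normalized (R : realType) (G : sgraph)
    (m : G -> R) (mu : G -> G -> R) : Prop :=
  (forall x y : G, adj x y -> mu x y = 1) /\
  (forall x : G, m x = \sum_(y \in nbrs x) mu x y).

Section Curvature.
Variables (R : realType) (G : sgraph) (m : G -> R) (mu : G -> G -> R).
Implicit Types f g : G -> R.

Definition laplacian f : G -> R :=
  fun x => (m x)^-1 * \sum_(y \in nbrs x) mu x y * (f y - f x).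

Definition Gamma f g : G -> R := fun x =>
  2^-1 * (laplacian (fun y => f y * g y) x
          - f x * laplacian g x - g x * laplacian f x).

Definition Gamma2 f : G -> R := fun x =>
  2^-1 * laplacian (Gamma f f) x - Gamma f (laplacian f) x.

Definition CD0oo : Prop := forall f (x : G), 0 <= Gamma2 f x.

End Curvature.

Definition graph_iso (G H : sgraph) : Prop :=
  exists2 h : G -> H, bijective h & forall x y : G, adj (h x) (h y) = adj x y.

Section GraphOfRel.
Variables (V : choiceType) (r : rel V).

Definition rel_adj : rel V := fun x y => (x != y) && (r x y || r y x).

Lemma rel_adj_sym : symmetric rel_adj.
Proof. by move=> x y; rewrite /rel_adj eq_sym orbC. Qed.

Lemma rel_adj_irr : irreflexive rel_adj.
Proof. by move=> x; rewrite /rel_adj eqxx. Qed.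

Definition graph_of_rel : sgraph := SGraph rel_adj_sym rel_adj_irr.

End GraphOfRel.

Definition path_graph (k : nat) : sgraph :=
  graph_of_rel (fun i j : 'I_k.+1 => j == i.+1 :> nat).

Definition cycle_graph (n : nat) : sgraph :=
  graph_of_rel (fun i j : 'I_n => j == i.+1 %[mod n])%N.

Definition line_graph_int : sgraph :=
  graph_of_rel (fun i j : int => j == i + 1).

Definition half_line_graph : sgraph :=
  graph_of_rel (fun i j : nat => j == i.+1).

(* None is the center. *)
Definition star_graph (n : nat) : sgraph :=
  graph_of_rel (fun x y : option 'I_n => (x == None) && (y != None)).

(* Star_3 with one pendant vertex inr j attached to each leaf j in A;
   Star_3^i is star3_ext A for any A with i elements. *)
Definition star3_ext (A : {set 'I_3}) : sgraph :=
  graph_of_rel (fun x y : option 'I_3 + {j : 'I_3 | j \in A} =>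
    match x, y with
    | inl u, inl v => (u == None) && (v != None)
    | inl u, inr j => u == Some (val j)
    | inr _, _ => false
    end).

(* Main.v *)
Require Import Defs.
From HB Require Import structures.
From mathcomp Require Import all_boot all_order all_algebra.
From mathcomp Require Import all_classical all_reals ereal.
From mathcomp Require Import zify ring lra.

(** Let x be a vertex with d neighbours y of degrees d_y.  Gamma2 f x
    depends on f near x and involves only edges that meet x or one of the y.
    Girth at least five means that these edges form a tree, so f can be
    prescribed freely on its vertices.  Take f x = 0, f y = a_y and f z = 2 a_y
    for the further neighbours z of y, which is the extension minimizing Gamma2.
    Then f changes by a_y in absolute value along every edge at y, the terms
    Gamma f cancel, and Gamma2 f x >= 0 becomes the quadratic inequality
      sum_y (1 - 2 / d_y) a_y^2  <=  (sum_y a_y)^2 / d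
    (curvature_ineq).

    Two choices of a suffice.  Putting the weight 2 d - 1 on one neighbour y
    and -1 on the others gives (2 d - 1) (1 - 2 / d_y) <= 1 (deg_trade).
    Hence a vertex of degree at least three only has neighbours of degree at
    most two, and even only leaves if its degree is at least four.  Putting
    1 and -1 on the two neighbours of a vertex of degree two shows that if one
    of them has degree at least three then the other one is a leaf
    (beyond_branch_deg).

    So if some vertex has degree at least three, the graph ends at distance at
    most two from it, and it is a star or Star_3 with some branches prolonged.
    Otherwise all degrees are at most two.  A walk which goes straight on
    wherever it can, continued in both directions unless it starts at an end,
    then visits the whole graph; according to the ends that it meets and to
    whether it comes back to its start, the graph is a path, a half line, a
    cycle or the line.

    All isomorphisms are obtained from one principle (graph_iso_of_rel): an
    injective homomorphism into a connected graph along which adjacency lifts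
    is an isomorphism. *)

Set Implicit Arguments.
Unset Strict Implicit.
Unset Printing Implicit Defensive.

Import Order.TTheory GRing.Theory Num.Theory.
Local Open Scope ring_scope.

(** * Neighbourhoods and short cycles *)

(** Sums over the classical set of neighbours become sums over this
    duplicate-free sequence, which is meaningful for locally finite graphs. *)
Definition nbr_seq (G : sgraph) (x : G) : seq G :=
  finmap.enum_fset (fset_set (nbrs x)).

Definition deg (G : sgraph) (x : G) : nat := size (nbr_seq x).

Lemma mem_nbr_seq (G : sgraph) (x y : G) :
  locally_finite G -> (y \in nbr_seq x) = adj x y.
Proof.
move=> lf; rewrite /nbr_seq in_fset_set //.
by apply/idP/idP; rewrite inE.
Qed.

Lemma nbr_seq_uniq (G : sgraph) (x : G) : uniq (nbr_seq x).
Proof. exact: finmap.fset_uniq. Qed.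

Definition no_triangle (G : sgraph) :=
  forall x y z : G, adj x y -> adj y z -> ~~ adj x z.

(** Uniqueness of common neighbours is the form in which the absence of
    4-cycles is used. *)
Definition no_square (G : sgraph) :=
  forall x y y' z : G,
    adj x y -> adj y z -> adj x y' -> adj y' z -> x != z -> y = y'.

Lemma girth_le_cycle (R : realType) (G : sgraph) (c : seq G) :
  is_graph_cycle c -> (girth R G <= (size c)%:R%:E)%E.
Proof.
move=> cc; have [c2 _] := cc.
case: c cc c2 => // x c cc _.
apply: (@le_trans _ _ (vertex_girth R x)).
  by apply: ereal_inf_lbound; exists x.
apply: ereal_inf_lbound; exists (x :: c) => //.
by split => //; rewrite inE eqxx.
Qed.

Lemma adj_neq (G : sgraph) (x y : G) : adj x y -> x != y.
Proof. by move=> xy; apply/eqP => E; move: xy; rewrite E adj_irr. Qed.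

Lemma girth_no_short_cycle (R : realType) (G : sgraph) (c : seq G) :
  ((5%:R : R)%:E <= girth R G)%E -> is_graph_cycle c -> (5 <= size c)%N.
Proof.
move=> g5 /(girth_le_cycle R) /(le_trans g5).
by rewrite lee_fin ler_nat.
Qed.

Lemma girth_no_triangle (R : realType) (G : sgraph) :
  ((5%:R : R)%:E <= girth R G)%E -> no_triangle G.
Proof.
move=> g5 x y z xy yz; apply/negP => xz.
suff /(girth_no_short_cycle g5) : is_graph_cycle [:: x; y; z] by [].
split => //; rewrite /ucycle /= xy yz (adj_sym z) xz /= !inE.
by rewrite !negb_or (adj_neq xy) (adj_neq yz) (adj_neq xz).
Qed.

Lemma girth_no_square (R : realType) (G : sgraph) :
  ((5%:R : R)%:E <= girth R G)%E -> no_square G.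
Proof.
move=> g5 x y y' z xy yz xy' y'z xz; apply/eqP; apply/negPn/negP => yy'.
suff /(girth_no_short_cycle g5) : is_graph_cycle [:: x; y; z; y'] by [].
split => //; rewrite /ucycle /= xy yz (adj_sym z) y'z (adj_sym y') xy' /= !inE.
rewrite !negb_or (adj_neq xy) (adj_neq yz) (adj_neq xy') xz yy' /=.
by rewrite eq_sym (adj_neq y'z).
Qed.

(** * The curvature condition as a quadratic form *)

Section Curvature.
Variables (R : realType) (G : sgraph) (m : G -> R) (mu : G -> G -> R).
Hypothesis Glf : locally_finite G.
Hypothesis Gun : unweighted_normalized m mu.
Implicit Types (f g a : G -> R) (x y z : G).

Lemma sum_nbr_const (c : R) x : \sum_(y <- nbr_seq x) c = (deg x)%:R * c.
Proof. by rewrite big_const_seq count_predT iter_addr_0 mulr_natl. Qed.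

Lemma weighted_sumE (F : G -> R) x :
  \sum_(y \in nbrs x) mu x y * F y = \sum_(y <- nbr_seq x) F y.
Proof.
rewrite fsbig_finite; last exact: Glf.
rewrite [LHS]big_seq [RHS]big_seq; apply: eq_bigr => y.
by rewrite -/(nbr_seq x) mem_nbr_seq // => /Gun.1 ->; rewrite mul1r.
Qed.

Lemma vertex_weightE x : m x = (deg x)%:R.
Proof.
rewrite Gun.2.
under eq_fsbigr do rewrite -[mu x _]mulr1.
by rewrite (weighted_sumE (fun=> 1)) sum_nbr_const mulr1.
Qed.

Lemma laplacianE f x :
  laplacian m mu f x = (deg x)%:R^-1 * \sum_(y <- nbr_seq x) (f y - f x).
Proof. by rewrite /laplacian vertex_weightE weighted_sumE. Qed.

Lemma GammaE f g x : Gamma m mu f g x =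
  2^-1 * ((deg x)%:R^-1 * \sum_(y <- nbr_seq x) (f y - f x) * (g y - g x)).
Proof.
rewrite /Gamma !laplacianE; congr (_ * _).
rewrite !(mulrCA _ _^-1) -!mulrBr; congr (_ * _).
rewrite !mulr_sumr -!sumrB; apply: eq_bigr => y _; ring.
Qed.

(** The test function.  The absence of triangles keeps the second sphere off
    the first one, and the absence of squares makes the value 2 a_y at a vertex
    z of the second sphere independent of the neighbour y below z. *)
Lemma exists_doubling a x : no_triangle G -> no_square G ->
  exists f, [/\ f x = 0, forall y, adj x y -> f y = a y &
    forall y z, adj x y -> adj y z -> z != x -> f z = 2 * a y].
Proof.
move=> G3 G4.
exists (fun w => if w == x then 0 else if adj x w then a w else
  2 * a (xget x [set y | adj x y /\ adj y w])); split.
- by rewrite eqxx.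
- by move=> y xy; rewrite eq_sym (negbTE (adj_neq xy)) xy.
- move=> y z xy yz zx; rewrite (negbTE zx) (negbTE (G3 _ _ _ xy yz)).
  congr (2 * a _).
  have [xw wz] : [set y | adj x y /\ adj y z]%classic
      (xget x [set y | adj x y /\ adj y z]) by apply: xgetPex; exists y.
  by apply: (G4 x _ _ z) => //; rewrite eq_sym.
Qed.

(** For the doubling function, every edge at a neighbour y of x contributes
    a_y^2, so Gamma f y = a_y^2 / 2 whatever the degree of y, and the part
    Delta (Gamma f) of Gamma2 vanishes at x; only Gamma (f, Delta f) is left,
    with Delta f y = (1 - 2 / d_y) a_y. *)
Lemma curvature_ineq a x : no_triangle G -> no_square G -> CD0oo m mu ->
  \sum_(y <- nbr_seq x) (1 - 2 / (deg y)%:R) * a y ^+ 2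
  <= (deg x)%:R^-1 * (\sum_(y <- nbr_seq x) a y) ^+ 2.
Proof.
move=> G3 G4 CD.
have [f [fx fy fz]] := exists_doubling a x G3 G4.
case: (posnP (deg x)) => [d0|dx].
  have -> : nbr_seq x = [::] by apply: size0nil.
  by rewrite !big_nil expr0n mulr0.
have degN0 y : adj x y -> (deg y)%:R != 0 :> R.
  rewrite adj_sym -mem_nbr_seq // pnatr_eq0 -lt0n /deg.
  by case: (nbr_seq y).
have Gy y : adj x y -> Gamma m mu f f y = 2^-1 * a y ^+ 2.
  move=> xy; rewrite GammaE; congr (_ * _).
  (* f z - f y is - a y for z = x and a y for the other neighbours. *)
  rewrite (_ : \sum_(z <- _) _ = \sum_(z <- nbr_seq y) a y ^+ 2).
    by rewrite sum_nbr_const mulKf ?degN0.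
  rewrite big_seq [RHS]big_seq; apply: eq_bigr => z.
  rewrite mem_nbr_seq // => yz; rewrite (fy y) //.
  have [->|zx] := eqVneq z x; first by rewrite fx; ring.
  by rewrite (fz y) //; ring.
have Ly y : adj x y -> laplacian m mu f y = (1 - 2 / (deg y)%:R) * a y.
  move=> xy; rewrite laplacianE.
  have xNy : x \in nbr_seq y by rewrite mem_nbr_seq // adj_sym.
  have -> : \sum_(z <- nbr_seq y) (f z - f y) = ((deg y)%:R - 2) * a y.
    rewrite (bigD1_seq x) ?nbr_seq_uniq //= fx (fy y) //.
    rewrite (_ : \sum_(z <- _ | _) _ = \sum_(z <- nbr_seq y | z != x) a y).
      have -> : \sum_(z <- nbr_seq y | z != x) a y = (deg y)%:R * a y - a y.
        rewrite -sum_nbr_const.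
        by rewrite [in RHS](bigD1_seq x) ?nbr_seq_uniq //= addrC addrK.
      ring.
    rewrite big_seq_cond [RHS]big_seq_cond; apply: eq_bigr => z.
    by rewrite mem_nbr_seq // => /andP[yz zx]; rewrite (fz y) //; ring.
  by have := degN0 _ xy => dy0; field.
have dx0 : (deg x)%:R != 0 :> R by rewrite pnatr_eq0 -lt0n.
have dxp : 0 < (deg x)%:R :> R by rewrite ltr0n.
have := CD f x; rewrite /Gamma2 laplacianE !GammaE fx !laplacianE fx.
set Sa := \sum_(y <- nbr_seq x) a y.
set Sq := \sum_(y <- nbr_seq x) a y ^+ 2.
set Sc := \sum_(y <- nbr_seq x) (1 - _) * _.
have -> : \sum_(y <- nbr_seq x) (f y - 0) = Sa.
  rewrite big_seq [RHS]big_seq; apply: eq_bigr => y.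
  by rewrite mem_nbr_seq // => /fy ->; rewrite subr0.
have -> : \sum_(y <- nbr_seq x) (f y - 0) * (f y - 0) = Sq.
  rewrite big_seq [RHS]big_seq; apply: eq_bigr => y.
  by rewrite mem_nbr_seq // => /fy ->; rewrite subr0.
set t := 2^-1 * (_^-1 * Sq).
have -> : \sum_(y <- nbr_seq x) (Gamma m mu f f y - t) = 0.
  rewrite sumrB sum_nbr_const.
  rewrite (_ : \sum_(y <- _) _ = 2^-1 * Sq); first by rewrite /t; field.
  rewrite mulr_sumr big_seq [RHS]big_seq; apply: eq_bigr => y.
  by rewrite mem_nbr_seq // => /Gy ->.
have -> : \sum_(y <- nbr_seq x) (f y - 0) *
   (laplacian m mu f y - (deg x)%:R^-1 * Sa) = Sc - (deg x)%:R^-1 * Sa ^+ 2.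
  rewrite (_ : _ * Sa ^+ 2 = \sum_(y <- nbr_seq x) (deg x)%:R^-1 * Sa * a y).
    rewrite /Sc -sumrB big_seq [RHS]big_seq; apply: eq_bigr => y.
    rewrite mem_nbr_seq // => xy; rewrite fy // Ly //; ring.
  by rewrite -mulr_sumr expr2 mulrA.
rewrite !mulr0 sub0r -mulrN pmulr_rge0 ?invr_gt0 // -mulrN.
by rewrite pmulr_rge0 ?invr_gt0 // oppr_ge0 subr_le0.
Qed.

End Curvature.

(** * Degrees of adjacent vertices *)

Section DegreeConstraints.
Variables (R : realType) (G : sgraph) (m : G -> R) (mu : G -> G -> R).
Hypothesis Glf : locally_finite G.
Hypothesis Gun : unweighted_normalized m mu.
Hypothesis (G3 : no_triangle G) (G4 : no_square G) (CD : CD0oo m mu).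
Implicit Types (x y z : G).

Lemma deg_gt0 x y : adj x y -> (0 < deg x)%N.
Proof. by rewrite -mem_nbr_seq // /deg; case: (nbr_seq x). Qed.

Lemma sub_nbr_deg (s : seq G) x :
  uniq s -> (forall y, y \in s -> adj x y) -> (size s <= deg x)%N.
Proof.
move=> us sx; apply: uniq_leq_size => // y /sx.
by rewrite mem_nbr_seq.
Qed.

Lemma deg_le1_nbr x y z : (deg x <= 1)%N -> adj x y -> adj x z -> z = y.
Proof.
move=> dx xy xz; apply/eqP; apply/negPn/negP => zy.
have : (size [:: z; y] <= deg x)%N.
  apply: sub_nbr_deg => [|w]; first by rewrite /= inE zy.
  by rewrite !inE => /orP[] /eqP ->.
by move=> /leq_trans/(_ dx).
Qed.

Lemma deg_le2_nbr x y z w : (deg x <= 2)%N ->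
  adj x y -> adj x z -> y != z -> adj x w -> w = y \/ w = z.
Proof.
move=> dx xy xz yz xw.
have [->|wy] := eqVneq w y; first by left.
have [->|wz] := eqVneq w z; first by right.
have : (size [:: w; y; z] <= deg x)%N.
  apply: sub_nbr_deg => [|v]; first by rewrite /= !inE negb_or wy wz yz.
  by rewrite !inE => /or3P[] /eqP ->.
by move=> /leq_trans/(_ dx).
Qed.

(** The weights 2 d - 1 and -1 minimize the quadratic form when all other
    neighbours are leaves.  The same bound follows for arbitrary degrees of the
    others, because 1 - 2 / d_w is smallest, namely -1, for a leaf w. *)
Lemma deg_trade x y : adj x y ->
  (2 * (deg x)%:R - 1) * (1 - 2 / (deg y)%:R) <= 1 :> R.
Proof.
move=> xy.
pose d : R := (deg x)%:R.
have d1 : 1 <= d by rewrite ler1n (deg_gt0 xy).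
pose a w : R := if w == y then 2 * d - 1 else - 1.
have yN : y \in nbr_seq x by rewrite mem_nbr_seq.
have := curvature_ineq Glf Gun a x G3 G4 CD.
have sum_others : \sum_(w <- nbr_seq x | w != y) (1 : R) = d - 1.
  rewrite -[d]mulr1 -sum_nbr_const [in RHS](bigD1_seq y) ?nbr_seq_uniq //=.
  by rewrite addrC addrK.
rewrite !(bigD1_seq y) ?nbr_seq_uniq //= {1 3}/a eqxx.
rewrite (_ : \sum_(w <- _ | _) a w = - (d - 1)); last first.
  by rewrite -sum_others -sumrN; apply: eq_bigr => w /negbTE wy; rewrite /a wy.
have others : - (d - 1) <=
    \sum_(w <- nbr_seq x | w != y) (1 - 2 / (deg w)%:R) * a w ^+ 2.
  rewrite -sum_others -sumrN big_seq_cond [leRHS]big_seq_cond.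
  apply: ler_sum => w /andP[]; rewrite mem_nbr_seq // => xw /negbTE wy.
  rewrite /a wy sqrrN expr1n mulr1.
  have dw : 1 <= (deg w)%:R :> R.
    by rewrite ler1n (@deg_gt0 w x) // adj_sym.
  have : (deg w)%:R^-1 <= 1 :> R by rewrite invf_le1 ?posrE; lra.
  lra.
rewrite -/d; set c := 1 - _; set O := bigop _ _ _ in others *.
have -> : 2 * d - 1 + - (d - 1) = d by ring.
have -> : d^-1 * d ^+ 2 = d by field; lra.
move=> H.
have {}H : (2 * d - 1) * ((2 * d - 1) * c) <= (2 * d - 1) * 1 by nra.
by move: H; rewrite ler_pM2l //; lra.
Qed.

Lemma branch_nbr_deg x y : (2 < deg x)%N -> adj x y -> (deg y <= 2)%N.
Proof.
move=> dx /deg_trade H; rewrite leqNgt; apply/negP => dy.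
have dx' : 3 <= (deg x)%:R :> R by rewrite ler_nat.
have dy' : 3 <= (deg y)%:R :> R by rewrite ler_nat.
have : (deg y)%:R^-1 <= 3^-1 :> R by rewrite lef_pV2 ?posrE; lra.
by move: H; set c := _^-1 => H cle; nra.
Qed.

Lemma large_branch_nbr_deg x y : (3 < deg x)%N -> adj x y -> (deg y <= 1)%N.
Proof.
move=> dx xy; rewrite leqNgt; apply/negP => dy.
have := deg_trade (etrans (adj_sym y x) xy).
have dx' : 4 <= (deg x)%:R :> R by rewrite ler_nat.
have dy' : 2 <= (deg y)%:R :> R by rewrite ler_nat.
have : (deg x)%:R^-1 <= 4^-1 :> R by rewrite lef_pV2 ?posrE; lra.
by set c := _^-1 => cle; nra.
Qed.

(** With a = 1 at x and a = -1 at z the right-hand side of the curvature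
    inequality at y vanishes, while the left-hand side is positive as soon as
    d_x >= 3 and d_z >= 2. *)
Lemma beyond_branch_deg x y z : (2 < deg x)%N -> adj x y -> adj y z ->
  z != x -> (deg z <= 1)%N.
Proof.
move=> dx xy yz zx; rewrite leqNgt; apply/negP => dz.
have yx : adj y x by rewrite adj_sym.
have dy := branch_nbr_deg dx xy.
pose a w : R := if w == x then 1 else - 1.
have := curvature_ineq Glf Gun a y G3 G4 CD.
have Ny (F : G -> R) : \sum_(w <- nbr_seq y) F w = F x + F z.
  have Nyxz : perm_eq (nbr_seq y) [:: x; z].
    apply: uniq_perm; rewrite ?nbr_seq_uniq //= ?inE 1?eq_sym ?zx // => w.
    rewrite mem_nbr_seq // !inE; apply/idP/orP => [yw|[]/eqP -> //].
    case: (deg_le2_nbr dy yx yz _ yw) => [|->|->].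
    - by rewrite eq_sym.
    - by left.
    - by right.
  by rewrite (perm_big _ Nyxz) big_cons big_seq1.
rewrite !Ny /a eqxx (negbTE zx) subrr expr0n mulr0 sqrrN expr1n !mulr1.
have dx' : 3 <= (deg x)%:R :> R by rewrite ler_nat.
have dz' : 2 <= (deg z)%:R :> R by rewrite ler_nat.
have : (deg x)%:R^-1 <= 3^-1 :> R by rewrite lef_pV2 ?posrE; lra.
have : (deg z)%:R^-1 <= 2^-1 :> R by rewrite lef_pV2 ?posrE; lra.
lra.
Qed.

End DegreeConstraints.

(** * Recognizing connected graphs *)

Lemma connected_closed (G : sgraph) (A : G -> Prop) (x : G) :
  connected_graph G -> A x -> (forall y z, A y -> adj y z -> A z) ->
  forall y, A y.
Proof.
move=> Gconn Ax AS y; have [p] := Gconn x y.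
elim: p x Ax => [|z p IH] x Ax /=; first by move=> _ <-.
by move=> /andP[xz]; apply: IH; apply: AS xz.
Qed.

Lemma exists_nbr (G : sgraph) (x : G) :
  connected_graph G -> nontrivial_graph G -> exists y, adj x y.
Proof.
move=> Gconn [u [v uv]].
suff [w wx] : exists w, w != x.
  have [[|y p] /=] := Gconn x w; first by move=> _ E; rewrite E eqxx in wx.
  by move=> /andP[xy _] _; exists y.
by have [ux|] := eqVneq u x; [exists v; rewrite -ux eq_sym | exists u].
Qed.

(** The lifting of adjacencies makes the image closed under adjacency, hence
    everything by connectedness; with injectivity it also shows that adjacency
    is reflected. *)
Lemma graph_iso_of_rel (G : sgraph) (V : choiceType) (r : rel V) (h : V -> G)
    (v0 : V) :
  connected_graph G -> injective h -> (forall u v, r u v -> adj (h u) (h v)) ->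
  (forall u w, adj (h u) w -> exists2 v, r u v || r v u & w = h v) ->
  graph_iso G (graph_of_rel r).
Proof.
move=> Gconn hinj hom lift.
have surj : forall x, exists v, h v = x.
  apply: (connected_closed (x := h v0)) => //; first by exists v0.
  by move=> _ z [v <-] /lift[w _ ->]; exists w.
pose g x := sval (cid (surj x)).
have gK : cancel g h by move=> x; rewrite /g; case: cid.
have hK : cancel h g by move=> v; apply: hinj; rewrite gK.
exists g; first by exists h.
move=> x y; rewrite -{2}(gK x) -{2}(gK y) /= /rel_adj.
move: (g x) (g y) => u v; apply/andP/idP => [[_]|uv].
  by case/orP => /hom //; rewrite adj_sym.
have [v' ruv /hinj vv'] := lift _ _ uv; rewrite vv'; split=> //.
by apply/eqP => E; move: uv; rewrite E vv' adj_irr.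
Qed.

(** * Graphs of maximal degree two *)

Section Walks.
Local Open Scope nat_scope.

(** When all degrees are at most two, such a walk moves on to the other
    neighbour of t n.+1, and turns back (t n.+2 = t n) only at a leaf. *)
Definition tracing_walk (G : sgraph) (t : nat -> G) : Prop :=
  forall n, adj (t n) (t n.+1) /\
    forall w, adj (t n.+1) w -> w = t n \/ w = t n.+2.

Lemma exists_tracing_walk (G : sgraph) (u v : G) :
  locally_finite G -> (forall x : G, deg x <= 2) -> adj u v ->
  exists t, [/\ t 0 = u, t 1 = v & tracing_walk t].
Proof.
move=> Glf d2 uv.
(* Coming from a to b, go on to a neighbour of b other than a, and return
   to a if there is none. *)
pose nx (a b : G) : G := xget a [set w | adj b w /\ w != a]%classic.
pose t n := (iter n (fun p : G * G => (p.2, nx p.1 p.2)) (u, v)).1.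
have tS n : iter n (fun p : G * G => (p.2, nx p.1 p.2)) (u, v) = (t n, t n.+1).
  by rewrite /t iterS; case: (iter _ _ _).
have tSS n : t n.+2 = nx (t n) (t n.+1) by rewrite {1}/t !iterS tS.
have nxP a b : adj a b -> adj b (nx a b) /\
    forall w, adj b w -> w = a \/ w = nx a b.
  move=> ab; rewrite /nx; case: xgetP => [w _ /= [bw wa]|none].
    split => // w' bw'; apply: (@deg_le2_nbr _ Glf b) => //.
    - by rewrite adj_sym.
    - by rewrite eq_sym.
  split; first by rewrite adj_sym.
  move=> w bw; left; apply/eqP; apply/negPn/negP => wa.
  by apply: (none w).
have adjt n : adj (t n) (t n.+1).
  by elim: n => // n /nxP[+ _]; rewrite -tSS.
exists t; split => // n; split => //.
by rewrite tSS; apply: (nxP _ _ (adjt n)).2.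
Qed.

(** If the walk met an interior vertex t i again at time n, it would arrive
    there from one of the two neighbours of t i, which were visited at times
    i - 1 and i + 1; so time n - 1 would already have been a repetition, or the
    walk would have turned back. *)
Lemma first_return_start (G : sgraph) (t : nat -> G) (n i : nat) :
  tracing_walk t -> (forall k, k.+2 <= n -> t k.+2 <> t k) ->
  (forall a b, a < n -> b < n -> t a = t b -> a = b) ->
  i < n -> t i = t n -> i = 0.
Proof.
move=> tw noref inj; case: i => // i; case: n noref inj => // n noref inj.
rewrite ltnS => i_n Ein.
have : adj (t i.+1) (t n) by rewrite Ein adj_sym; apply: (tw n).1.
case/(tw i).2 => [/inj|E]; first by lia.
have [E2|ne] := eqVneq i.+1 n.
  by move: (tw i.+1).1; rewrite {1}E2 -E adj_irr.
have {}E : n = i.+2 by apply: inj => //; lia.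
by subst n; case: (noref i.+1).
Qed.

(** A first repetition would be a return to t 0; its only neighbour being t 1,
    the walk would have come back through t 1, which again is a repetition. *)
Lemma walk_from_end_inj (G : sgraph) (t : nat -> G) (n : nat) :
  tracing_walk t -> (forall w, adj (t 0) w -> w = t 1) ->
  (forall k, k.+2 <= n -> t k.+2 <> t k) ->
  forall a b, a <= n -> b <= n -> t a = t b -> a = b.
Proof.
move=> tw end0; elim: n => [|n IH] noref; first by lia.
have {}IH : forall a b, a < n.+1 -> b < n.+1 -> t a = t b -> a = b.
  by apply: IH => k kn; apply: noref; lia.
have new i : i < n.+1 -> t i <> t n.+1.
  move=> ile E; have i0 := first_return_start tw noref IH ile E.
  have : adj (t 0) (t n).
    by rewrite -i0 E adj_sym; apply: (tw n).1.
  move/end0 => E1; case: n => [|n] in noref IH ile E E1 *.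
    by move: (tw 0).1; rewrite -E1 adj_irr.
  have {}E1 : n.+1 = 1 by apply: IH => //; lia.
  by subst i; case: E1 => n0; subst n; case: (noref 0).
move=> a b; rewrite leq_eqVlt => /predU1P[->|an];
  rewrite leq_eqVlt => /predU1P[->|bn] //.
- by move/esym/new => /(_ bn).
- by move/new => /(_ an).
- exact: IH.
Qed.

(** The walk from the end e either goes on forever or stops at the first vertex
    where it turns back, which is the other end. *)
Lemma iso_path_of_end (G : sgraph) (e : G) :
  connected_graph G -> nontrivial_graph G -> locally_finite G ->
  (forall x : G, deg x <= 2) -> deg e <= 1 ->
  (exists2 k : nat, 1 <= k & graph_iso G (path_graph k)) \/
  graph_iso G half_line_graph.
Proof.
move=> Gconn Gnt Glf d2 de.
have [v ev] := exists_nbr e Gconn Gnt.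
have [t [t0 t1 tw]] := exists_tracing_walk Glf d2 ev.
have end0 w : adj (t 0) w -> w = t 1.
  by rewrite t0 t1; apply: deg_le1_nbr.
have [turns|noref] := pselect (exists n, t n.+2 == t n); last first.
  have {}noref n : t n.+2 <> t n by move=> /eqP E; apply: noref; exists n.
  right; apply: (graph_iso_of_rel (h := t)) => //.
  - exact: 0.
  - move=> a b; apply: (@walk_from_end_inj _ t (a + b)) => //; lia.
  - by move=> i j /eqP ->; apply: (tw i).1.
  - case=> [|i] w; first by move=> /end0 ->; exists 1.
    move/(tw i).2 => [->|->]; first by exists i => //; rewrite eqxx orbT.
    by exists i.+2 => //; rewrite eqxx.
left; case: (ex_minnP turns) => k /eqP kP kmin.
exists k.+1 => //.
have lt_i (i : 'I_k.+2) : (i <= k.+1) by rewrite -ltnS ltn_ord.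
apply: (graph_iso_of_rel (h := fun i : 'I_k.+2 => t i)) => //.
- exact: ord0.
- move=> i j E; apply: val_inj.
  apply: (walk_from_end_inj tw end0 _ (lt_i i) (lt_i j) E).
  by move=> l lk /eqP/kmin; lia.
- by move=> i j /eqP ->; apply: (tw i).1.
- case=> -[|i] ik w /=.
    move=> /end0 ->; exists (Ordinal (isT : 1 < k.+2)) => //.
  move/(tw i).2 => Ew.
  have {Ew}[->|[ik2 ->]] : w = t i \/ i.+2 < k.+2 /\ w = t i.+2.
  + case: Ew => [->|->]; first by left.
    have [E|ne] := eqVneq i k; first by left; rewrite E kP.
    by right; split => //; lia.
  + by exists (Ordinal (ltnW ik)) => //=; rewrite eqxx orbT.
  + by exists (Ordinal ik2) => //=; rewrite eqxx.
Qed.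

(** The first repetition is a return to the start, so the vertices before it
    form a cycle; it takes up both neighbours of each of its vertices. *)
Lemma iso_cycle_of_return (G : sgraph) (t : nat -> G) :
  connected_graph G -> locally_finite G -> no_triangle G -> no_square G ->
  (forall x : G, deg x <= 2) ->
  tracing_walk t -> (forall n, t n.+2 <> t n) -> ~ injective t ->
  exists2 n : nat, 5 <= n & graph_iso G (cycle_graph n).
Proof.
move=> Gconn Glf G3 G4 d2 tw noref ninj.
pose ret n := `[< exists2 i, i < n & t i = t n >].
have : exists n, ret n.
  apply: contrapT => nret; apply: ninj => a b E.
  by case: (ltngtP a b) => // lt; case: nret; [exists b|exists a];
    apply/asboolP; [exists a|exists b].
case/ex_minnP => n /asboolP[i i_n Ein] nmin.
have inj a b : a < n -> b < n -> t a = t b -> a = b.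
  move=> an bn E; case: (ltngtP a b) => // ab.
    by have : ret b by [apply/asboolP; exists a]; move=> /nmin; lia.
  by have : ret a by [apply/asboolP; exists b]; move=> /nmin; lia.
have i0 := first_return_start tw (fun k _ => noref k) inj i_n Ein.
rewrite {}i0 in i_n Ein.
have adjt k := (tw k).1.
(* A return after one to four steps would be a loop, a reversal, a triangle
   or a square. *)
have n5 : 5 <= n.
  case: n i_n Ein inj {nmin} => [|[|[|[|[|n]]]]] // _ E inj.
  - by move: (adjt 0); rewrite E adj_irr.
  - by case: (noref 0).
  - have := G3 _ _ _ (adjt 0) (adjt 1).
    by rewrite adj_sym E adjt.
  - suff : 1 = 3 by [].
    apply: inj => //; apply: (G4 (t 0) _ _ (t 2)); rewrite ?adjt //.
      by rewrite adj_sym E adjt.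
      by rewrite adj_sym adjt.
    by apply/eqP => /esym/noref.
exists n => //.
have tmod k : k <= n -> t (k %% n) = t k.
  by case: (ltngtP k n) => // [kn _|-> _]; [rewrite modn_small|rewrite modnn].
have n0 : (0 < n) by [].
pose o k : 'I_n := Ordinal (ltn_pmod k n0).
apply: (graph_iso_of_rel (h := fun i : 'I_n => t i)) => //.
- exact: (o 0).
- by move=> a b /(inj _ _ (ltn_ord a) (ltn_ord b)) /val_inj.
- move=> a b; rewrite [X in X == _]modn_small // => /eqP ->.
  by rewrite tmod.
- move=> [a an] w /= aw.
  have [->|[b [bn ba ->]]] : w = t a.+1 \/
      exists b, [/\ b < n, b.+1 = a %[mod n] & w = t b].
  + case: a an aw => [|a] an; last first.
      by case/(tw a).2 => ->; [right; exists a; split => //; lia|left].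
    have n1 : n.-1.+1 = n by rewrite prednK.
    have prev : adj (t 0) (t n.-1) by rewrite Ein -n1 adj_sym.
    case/(deg_le2_nbr Glf (d2 _) (adjt 0) prev).
    * by apply/eqP => /inj; lia.
    * by left.
    * by right; exists n.-1; rewrite n1 modnn mod0n; split => //; lia.
  + exists (o a.+1); last by rewrite /= tmod.
    by rewrite /= modn_mod eqxx.
  + exists (Ordinal bn) => //=.
    by rewrite -ba eqxx orbT.
Qed.

End Walks.

(** Two walks leaving x in the two directions form a bi-infinite walk s.  It is
    injective because any two of its times lie on a half-infinite part, which
    is again a tracing walk. *)
Lemma iso_line_of_injective (G : sgraph) (x : G) :
  connected_graph G -> locally_finite G ->
  (forall y : G, deg y = 2%N) ->
  (forall t : nat -> G, tracing_walk t -> injective t) ->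
  graph_iso G line_graph_int.
Proof.
move=> Gconn Glf d2 allinj.
have d2' (y : G) : (deg y <= 2)%N by rewrite d2.
have [a [b [xa xb ab]]] : exists a b, [/\ adj x a, adj x b & a != b].
  have := d2 x; have := nbr_seq_uniq x; have := fun y => mem_nbr_seq x y Glf.
  rewrite /deg; case: (nbr_seq x) => [|a [|b [|]]] //= mem /andP[ab _] _.
  exists a, b; rewrite -!mem !inE !eqxx !orbT; split => //.
  by move: ab; rewrite inE.
have [t [t0 t1 tw]] := exists_tracing_walk Glf d2' xa.
have [t' [t'0 t'1 tw']] := exists_tracing_walk Glf d2' xb.
(* Negz n is the integer - (n + 1). *)
pose s (i : int) := match i with Posz n => t n | Negz n => t' n.+1 end.
have predN n : (Negz n - 1 = Negz n.+1)%R by lia.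
have succN n : (Negz n.+1 + 1 = Negz n)%R by lia.
have sadj i : adj (s i) (s (i + 1)).
  case: i => [n|[|n]].
    by rewrite -[Posz n + 1]/(Posz (n + 1)) addn1 (tw n).1.
    by rewrite (_ : Negz 0 + 1 = Posz 0) //= t'1 t0 adj_sym.
  by rewrite succN /= adj_sym (tw' n.+1).1.
have snbr i w : adj (s i) w -> w = s (i - 1) \/ w = s (i + 1).
  case: i => [[|n]|n].
  - rewrite (_ : Posz 0 - 1 = Negz 0) // (_ : Posz 0 + 1 = Posz 1) //=.
    rewrite t0 t1 t'1.
    by apply: (deg_le2_nbr Glf (d2' x)) => //; rewrite eq_sym.
  - rewrite (_ : n.+1%:Z - 1 = n); last by lia.
    rewrite (_ : n.+1%:Z + 1 = n.+2); last by lia.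
    exact: (tw n).2.
  - rewrite predN /= => /(tw' n).2[->|->]; last by left.
    right; case: n => [|n]; last by rewrite succN.
    by rewrite (_ : Negz 0 + 1 = Posz 0) //= t'0 t0.
have sinj : injective s.
  move=> i j E; pose k := (`|i| + `|j|)%N.
  pose u n := s (n%:Z - k%:Z).
  have uw : tracing_walk u.
    move=> n; rewrite /u (_ : n.+1%:Z - k%:Z = n%:Z - k%:Z + 1); last by lia.
    rewrite (_ : n.+2%:Z - k%:Z = n%:Z - k%:Z + 1 + 1); last by lia.
    by split => // w /snbr; rewrite addrK.
  have Ei : (absz (i + k%:Z))%:Z - k%:Z = i by rewrite /k; lia.
  have Ej : (absz (j + k%:Z))%:Z - k%:Z = j by rewrite /k; lia.
  have /(allinj _ uw) Eu : u (absz (i + k%:Z)) = u (absz (j + k%:Z)).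
    by rewrite /u Ei Ej.
  by rewrite -Ei -Ej Eu.
apply: (graph_iso_of_rel (h := s)) => //.
- exact: 0.
- by move=> i j /eqP ->.
- move=> i w /snbr[->|->]; [exists (i - 1)|exists (i + 1)] => //.
    by rewrite subrK eqxx orbT.
  by rewrite eqxx.
Qed.

Lemma degree_le2_classification (G : sgraph) :
  connected_graph G -> nontrivial_graph G -> locally_finite G ->
  no_triangle G -> no_square G -> (forall x : G, (deg x <= 2)%N) ->
  (exists2 k : nat, (1 <= k)%N & graph_iso G (path_graph k)) \/
  (exists2 n : nat, (5 <= n)%N & graph_iso G (cycle_graph n)) \/
  graph_iso G line_graph_int \/
  graph_iso G half_line_graph.
Proof.
move=> Gconn Gnt Glf G3 G4 d2.
have [[e de]|noend] := pselect (exists e : G, (deg e <= 1)%N).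
  by have [|] := iso_path_of_end Gconn Gnt Glf d2 de; auto.
have {}noend (x : G) : deg x = 2%N.
  apply/eqP; rewrite eqn_leq d2 ltnNge; apply/negP => dx.
  by apply: noend; exists x.
have [x _] := Gnt.
(* Turning back at t n.+1 would make t n its only neighbour. *)
have noref (t : nat -> G) : tracing_walk t -> forall n, t n.+2 <> t n.
  move=> tw n E.
  have : (deg (t n.+1) <= size [:: t n])%N.
    apply: uniq_leq_size => [|w]; first exact: nbr_seq_uniq.
    by rewrite mem_nbr_seq // inE => /(tw n).2[] ->; rewrite ?E.
  by rewrite noend.
have [allinj|] := pselect (forall t : nat -> G, tracing_walk t -> injective t).
  by right; right; left; apply: iso_line_of_injective.
move=> /existsNP[t] /not_implyP[tw tninj].
by right; left; apply: iso_cycle_of_return tninj => //; apply: noref.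
Qed.

(** * Graphs with a vertex of degree at least three *)

Section Branching.
Variables (G : sgraph) (x : G).
Hypotheses (Gconn : connected_graph G) (Glf : locally_finite G).

Lemma enum_nbrs : exists y : 'I_(deg x) -> G,
  [/\ forall i, adj x (y i), injective y &
    forall w, adj x w -> exists i, w = y i].
Proof.
exists (fun i => nth x (nbr_seq x) i); split => [i|i j /eqP|w].
- by rewrite -mem_nbr_seq // mem_nth.
- by rewrite nth_uniq ?nbr_seq_uniq // => /eqP/val_inj.
- rewrite -mem_nbr_seq // => wN.
  have wi : (index w (nbr_seq x) < deg x)%N by rewrite index_mem.
  by exists (Ordinal wi); rewrite /= nth_index.
Qed.

Lemma iso_star_of_leaves :
  (forall z, adj x z -> (deg z <= 1)%N) -> graph_iso G (star_graph (deg x)).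
Proof.
move=> leaf; have [y [adj_y y_inj y_surj]] := enum_nbrs.
have y_neq i : (y i == x) = false by rewrite eq_sym; apply/negbTE/adj_neq.
pose h (u : option 'I_(deg x)) := oapp y x u.
apply: (graph_iso_of_rel (h := h)) => //.
- exact: None.
- move=> [i|] [j|] //= E.
  + by rewrite (y_inj _ _ E).
  + by have := y_neq i; rewrite E eqxx.
  + by have := y_neq j; rewrite -E eqxx.
- by move=> [i|] [j|] //= _; apply: adj_y.
- move=> [i|] w /= iw.
    have ix : adj (y i) x by rewrite adj_sym.
    by exists None => //=; apply: deg_le1_nbr iw => //; apply: leaf.
  by have [i ->] := y_surj _ iw; exists (Some i).
Qed.

(** The second alternative requires a nonempty set of prolonged branches, since
    star3_ext of the empty set is the plain star covered by the first one. *)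
Lemma iso_star3_of_short_branches : deg x = 3%N -> no_triangle G ->
  (forall z, adj x z -> (deg z <= 2)%N) ->
  (forall z w, adj x z -> adj z w -> w != x -> (deg w <= 1)%N) ->
  (forall z, adj x z -> (deg z <= 1)%N) \/
  exists2 A : {set 'I_3}, (0 < #|A|)%N & graph_iso G (star3_ext A).
Proof.
move=> dx3 G3 dy dz.
have [leaf|nleaf] := pselect (forall z, adj x z -> (deg z <= 1)%N).
  by left.
right; have := enum_nbrs; rewrite dx3 => -[y [adj_y y_inj y_surj]].
have y_neq i : (y i == x) = false by rewrite eq_sym; apply/negbTE/adj_neq.
have y_adj i : adj (y i) x by rewrite adj_sym.
(* The branches that do not stop at a neighbour of x. *)
pose A := [set i | (1 < deg (y i))%N].
exists A.
  rewrite lt0n; apply/negP; rewrite cards_eq0 => /eqP A0; apply: nleaf => z.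
  move=> /y_surj[i ->]; rewrite leqNgt; apply/negP => di.
  have : i \in A by rewrite inE.
  by rewrite A0 inE.
pose z i := xget x [set w | adj (y i) w /\ w != x]%classic.
have zP i : i \in A -> adj (y i) (z i) /\ z i != x.
  rewrite inE => di.
  apply: (xgetPex x (P := [set w | adj (y i) w /\ w != x]%classic)).
  apply: contrapT => none; move: di; rewrite ltnNge => /negP; apply.
  apply: (@uniq_leq_size _ _ [:: x]); first exact: nbr_seq_uniq.
  move=> w; rewrite mem_nbr_seq // inE => iw; apply/negPn/negP => wx.
  by apply: none; exists w.
have z_leaf i : i \in A -> (deg (z i) <= 1)%N.
  by move=> /zP[yz zx]; apply: dz yz zx.
have zy i : i \in A -> adj (z i) (y i) by move=> /zP[]; rewrite adj_sym.
have z_neq_y i j : i \in A -> z i <> y j.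
  by move=> iA E; have := G3 _ _ _ (adj_y i) (zP i iA).1; rewrite E adj_y.
pose h (u : option 'I_3 + {j : 'I_3 | j \in A}) : G :=
  match u with inl u => oapp y x u | inr j => z (val j) end.
apply: (graph_iso_of_rel (h := h)) => //.
- exact: (inl None).
- move=> [[i|]|[i iA]] [[j|]|[j jA]] //= E.
  + by rewrite (y_inj _ _ E).
  + by have := y_neq i; rewrite E eqxx.
  + by case: (z_neq_y j i jA).
  + by have := y_neq j; rewrite -E eqxx.
  + by have [_] := zP _ jA; rewrite E eqxx.
  + by case: (z_neq_y i j iA).
  + by have [_] := zP _ iA; rewrite E eqxx.
  + congr inr; apply: val_inj; apply: y_inj => /=.
    by apply: (deg_le1_nbr Glf (z_leaf _ jA) (zy _ jA)); rewrite -E zy.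
- by move=> [[i|]|[i iA]] [[j|]|[j jA]] //= /eqP // [->]; apply: (zP _ jA).1.
- move=> [[i|]|[i iA]] w /= iw.
  + have [->|wx] := eqVneq w x; first by exists (inl None).
    have iA : i \in A.
      rewrite inE; apply: (@leq_trans (size [:: x; w])) => //.
      apply: sub_nbr_deg => // [|v]; first by rewrite /= inE eq_sym wx.
      by rewrite !inE => /orP[] /eqP ->.
    exists (inr (exist _ i iA)) => /=; first by rewrite eqxx.
    have [yz zx] := zP i iA.
    have xz : x != z i by rewrite eq_sym.
    have [E|//] := deg_le2_nbr Glf (dy _ (adj_y i)) (y_adj i) yz xz iw.
    by rewrite E eqxx in wx.
  + by have [j ->] := y_surj _ iw; exists (inl (Some j)).
  + exists (inl (Some i)) => /=; first by rewrite eqxx.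
    exact: (deg_le1_nbr Glf (z_leaf _ iA) (zy _ iA)).
Qed.

End Branching.

Theorem theorem1p3 (R : realType) (G : sgraph) (m : G -> R) (mu : G -> G -> R)
  (Gconn : connected_graph G)
  (Glf : locally_finite G)
  (Gnt : nontrivial_graph G)
  (Gun : unweighted_normalized m mu)
  (GCD : CD0oo m mu)
  (Ggirth : ((5%:R : R)%:E <= girth R G)%E) :
  ((exists2 k : nat, (1 <= k)%N & graph_iso G (path_graph k)) \/
   (exists2 n : nat, (5 <= n)%N & graph_iso G (cycle_graph n)) \/
   graph_iso G line_graph_int \/
   graph_iso G half_line_graph) \/
  ((exists2 n : nat, (3 <= n)%N & graph_iso G (star_graph n)) \/
   (exists i : nat, (1 <= i <= 3)%N /\
      exists2 A : {set 'I_3}, #|A| = i & graph_iso G (star3_ext A))).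
Proof.
have G3 := girth_no_triangle Ggirth.
have G4 := girth_no_square Ggirth.
have [d2|] := pselect (forall x : G, (deg x <= 2)%N).
  by left; apply: degree_le2_classification.
move=> /existsNP[x /negP]; rewrite -ltnNge => dx; right.
suff : (forall z, adj x z -> (deg z <= 1)%N) \/
    exists2 A : {set 'I_3}, (0 < #|A|)%N & graph_iso G (star3_ext A).
  case=> [leaf|[A A0 GA]].
    by left; exists (deg x) => //; apply: iso_star_of_leaves.
  right; exists #|A|; split; last by exists A.
  by rewrite A0 -[leqRHS]card_ord max_card.
have [dx4|dx3] := ltnP 3 (deg x).
  by left=> z; apply: (large_branch_nbr_deg Glf Gun G3 G4 GCD dx4).
apply: iso_star3_of_short_branches => //.
- by apply/eqP; rewrite eqn_leq dx3.
- by move=> z; apply: (branch_nbr_deg Glf Gun G3 G4 GCD dx).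
- by move=> z w; apply: (beyond_branch_deg Glf Gun G3 G4 GCD dx).
Qed.
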